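(* Let $k\geq1$. A pointed $k$-neighborly polyhedral cone in $\mathbb{R}^m$ is $k$-Terracini convex.
   Context: A convex cone $\mathcal{K}$ is pointed if $\mathcal{K}\cap(-\mathcal{K})=\{0\}$. Fix an inner product on $\mathbb{R}^m$ with unit sphere $\mathcal{S}^{m-1}$; $\mathrm{ext}(\mathcal{K})$ is the set of (nonzero) generators of extreme rays of $\mathcal{K}$, and elements of $\mathrm{ext}(\mathcal{K})\cap\mathcal{S}^{m-1}$ are normalized extreme rays. A closed, pointed, convex cone $\mathcal{K}\subseteq\mathbb{R}^m$ is $k$-neighborly if for every collection $x^{(1)},\ldots,x^{(k)}$ of (not necessarily distinct) normalized extreme rays of $\mathcal{K}$ there exists a linear functional $\ell:\mathbb{R}^m\to\mathbb{R}$ with $\ell(x^{(i)})=0$ for all $i$ and $\ell(x)>0$ for all $x\in(\mathrm{ext}(\mathcal{K})\cap\mathcal{S}^{m-1})\setminus\{x^{(1)},\ldots,x^{(k)}\}$. For $x\in\mathcal{K}$, let $\mathcal{T}_{\mathcal{K}}(x)=\overline{\mathrm{cone}\{z-x:z\in\mathcal{K}\}}$ be the tangent cone and $\mathcal{L}_{\mathcal{K}}(x)=\mathcal{T}_{\mathcal{K}}(x)\cap(-\mathcal{T}_{\mathcal{K}}(x))$ the convex tangent space. $\mathcal{K}$ is $k$-Terracini convex if $\mathcal{L}_{\mathcal{K}}\big(\sum_{i=1}^kx^{(i)}\big)=\sum_{i=1}^k\mathcal{L}_{\mathcal{K}}(x^{(i)})$ for any collection $x^{(1)},\ldots,x^{(k)}$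 of (not necessarily distinct) generators of extreme rays of $\mathcal{K}$. *)

(* Defs.v *)
From HB Require Import structures.
From mathcomp Require Import all_boot all_order all_algebra.
From mathcomp Require Import all_classical all_reals all_analysis.

Set Implicit Arguments.
Unset Strict Implicit.
Unset Printing Implicit Defensive.

Import Order.TTheory GRing.Theory Num.Theory.
Import numFieldNormedType.Exports.

Local Open Scope classical_set_scope.
Local Open Scope ring_scope.

Section Cones.
Variables (R : realType) (m : nat).
Local Notation V := 'rV[R]_m.
Implicit Types (K S F : set V) (x y z : V).

(* The empty set is a convex cone here; pointedness excludes it. *)
Definition convex_cone K : Prop :=
  @convex_set R V K /\ (forall (a : R) x, 0 <= a -> K x -> K (a *: x)).

Definition pointed_cone K : Prop := K `&` [set - x | x in K] = [set 0].

(* Finite intersections of closed homogeneous half-spaces; the columns of A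
   are the inner normals. *)
Definition polyhedral_cone K : Prop :=
  exists (p : nat) (A : 'M[R]_(m, p)), K = [set x | forall j, 0 <= (x *m A) 0 j].

Definition conic_hull S : set V :=
  [set y | exists (n : nat) (a : 'I_n -> R) (s : 'I_n -> V),
    [/\ forall i, 0 <= a i, forall i, S (s i) & y = \sum_(i < n) a i *: s i]].

Definition ray x : set V := [set a *: x | a in [set a : R | 0 <= a]].

(* For convex subcones F of a convex cone K, this is the usual notion of a face
   defined by open segments of K meeting F. *)
Definition face_of_cone K F : Prop :=
  F `<=` K /\ (forall y z, K y -> K z -> F (y + z) -> F y /\ F z).

Definition ext K : set V := [set x | x != 0 /\ face_of_cone K (ray x)].

Definition unit_sphere (ip : {dot V for idfun}) : set V :=
  [set x | ip x x = 1].

Definition normalized_ext (ip : {dot V for idfun}) K : set V :=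
  ext K `&` unit_sphere ip.

Definition neighborly (ip : {dot V for idfun}) (k : nat) K : Prop :=
  [/\ closed K, pointed_cone K, convex_cone K &
    forall x : 'I_k -> V, (forall i, normalized_ext ip K (x i)) ->
      exists l : {scalar V},
        (forall i, l (x i) = 0) /\
        (forall y, (normalized_ext ip K `\` range x) y -> 0 < l y)].

Definition tangent_cone K x : set V :=
  closure (conic_hull [set z - x | z in K]).

Definition convex_tangent_space K x : set V :=
  tangent_cone K x `&` [set - y | y in tangent_cone K x].

Definition minkowski_sum (k : nat) (L : 'I_k -> set V) : set V :=
  [set y | exists u : 'I_k -> V,
    (forall i, L i (u i)) /\ y = \sum_(i < k) u i].

Definition terracini_convex (k : nat) K : Prop :=
  forall x : 'I_k -> V, (forall i, ext K (x i)) ->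
    convex_tangent_space K (\sum_(i < k) x i) =
    minkowski_sum (fun i => convex_tangent_space K (x i)).

End Cones.

(* Main.v *)
Require Import Defs.
From HB Require Import structures.
From mathcomp Require Import all_boot all_order all_algebra.
From mathcomp Require Import all_classical all_reals all_analysis.

(** For [K = {x | x A >= 0}] and [x] in [K], the convex tangent space of [K] at
    [x] is the set of [y] with [(y A)_j = 0] whenever the constraint [j] is
    active at [x].  A constraint active at [x_1 + ... + x_k] is active at each
    [x_i], which gives one inclusion.  For the other one, take [y] in the convex
    tangent space at [x = x_1 + ... + x_k], so that [x + e y] and [x - e' y] lie
    in [K] for some [e, e' > 0].  A pointed polyhedral cone is generated by its
    extreme rays, hence the functional [l] provided by neighborliness is
    nonnegative on [K] and its zeros in [K] are combinations of the [x_i].  From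
    [l x = 0] we get [l y = 0], so [x + e y] is such a zero. *)

Set Implicit Arguments.
Unset Strict Implicit.
Unset Printing Implicit Defensive.

Import Order.TTheory GRing.Theory Num.Theory.
Import numFieldNormedType.Exports.

Local Open Scope classical_set_scope.
Local Open Scope ring_scope.

Section PolyhedralCone.
Variables (R : realType) (m p : nat) (A : 'M[R]_(m, p)).
Local Notation V := 'rV[R]_m.
Implicit Types (x y z u : V) (j : 'I_p).

Definition hcone : set V := [set x | forall j, 0 <= (x *m A) 0 j].

Lemma coordD x y j : ((x + y) *m A) 0 j = (x *m A) 0 j + (y *m A) 0 j.
Proof. by rewrite mulmxDl mxE. Qed.

Lemma coordZ (a : R) x j : ((a *: x) *m A) 0 j = a * (x *m A) 0 j.
Proof. by rewrite -scalemxAl mxE. Qed.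

Lemma coordN x j : ((- x) *m A) 0 j = - (x *m A) 0 j.
Proof. by rewrite mulNmx mxE. Qed.

Lemma coord_sum (I : finType) (f : I -> V) j :
  ((\sum_i f i) *m A) 0 j = \sum_i (f i *m A) 0 j.
Proof. by rewrite mulmx_suml summxE. Qed.

Lemma hcone0 : hcone 0.
Proof. by move=> j; rewrite mul0mx mxE. Qed.

Lemma hconeD x y : hcone x -> hcone y -> hcone (x + y).
Proof. by move=> Kx Ky j; rewrite coordD addr_ge0. Qed.

Lemma hconeZ (a : R) x : 0 <= a -> hcone x -> hcone (a *: x).
Proof. by move=> a0 Kx j; rewrite coordZ mulr_ge0. Qed.

Lemma hcone_sum (I : finType) (f : I -> V) :
  (forall i, hcone (f i)) -> hcone (\sum_i f i).
Proof. by move=> Kf j; rewrite coord_sum sumr_ge0// => i _; exact: Kf. Qed.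

(* The ratio test: move from [x] along [- y] until a constraint gets tight. *)
Lemma hcone_exit x y : hcone x -> ~ hcone (- y) ->
  exists t j, [/\ 0 <= t, hcone (x - t *: y),
    ((x - t *: y) *m A) 0 j = 0 & 0 < (y *m A) 0 j].
Proof.
move=> Kx /existsNP[j0]; rewrite coordN oppr_ge0 => /negP; rewrite -ltNge => yj0.
have [j yj jmin] := @arg_minP _ _ _ j0 (fun j => 0 < (y *m A) 0 j)
  (fun j => (x *m A) 0 j / (y *m A) 0 j) yj0.
exists ((x *m A) 0 j / (y *m A) 0 j), j.
have t0 : 0 <= (x *m A) 0 j / (y *m A) 0 j by rewrite divr_ge0// ltW.
split => // [i|]; rewrite coordD coordN coordZ; last first.
  by rewrite divfK ?gt_eqF// subrr.
rewrite subr_ge0; have [yi|yi] := ltP 0 ((y *m A) 0 i).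
  by rewrite -ler_pdivlMr//; exact: jmin.
by apply: le_trans (Kx i); rewrite mulr_ge0_le0.
Qed.

(** If [y] is not in the cone, the ratio test along [- y] gives a step [t] at which some constraint
    [j] decreasing along [y] becomes tight. If [t] were [0], this [j] would be active at [x],
    against the assumption on [y]. *)
Lemma hcone_feasible x y : hcone x ->
  (forall j, (x *m A) 0 j = 0 -> 0 <= (y *m A) 0 j) ->
  exists2 e : R, 0 < e & hcone (x + e *: y).
Proof.
move=> Kx xy; have [Ky|NKy] := pselect (hcone y).
  by exists 1 => //; rewrite scale1r; exact: hconeD.
have [|t [j []]] := @hcone_exit x (- y) Kx; first by rewrite opprK.
rewrite scalerN opprK coordN oppr_gt0 => t0 Kxty xtyj yj; exists t => //.
rewrite lt_def t0 andbT; apply/eqP => t_eq0.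
move: xtyj; rewrite t_eq0 scale0r addr0 => /xy.
by rewrite leNgt yj.
Qed.

(** * Tangent cones and convex tangent spaces *)

Lemma closed_dual_cone (J : set 'I_p) :
  closed [set y : V | forall j, J j -> 0 <= (y *m A) 0 j].
Proof.
rewrite (_ : [set y | _] =
  \bigcap_(j in J) ((fun y => (y *m A) 0 j) @^-1` [set r : R | 0 <= r])).
  apply: closed_bigI => j _; apply: preimage_closed; last exact: closed_ge.
  rewrite (_ : (fun y => _) = fun y => \sum_i y 0 i * A i j).
    move=> y _; apply: (continuous_big (@add_continuous R)) => i _ {}y.
    exact: (cvgMr_tmp (@coord_continuous _ _ _ 0 i y)).
  by apply/funext => y; rewrite mxE.
by apply/seteqP; split => y /= yJ j; [exact: yJ | exact: yJ].
Qed.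

Lemma tangent_coneE x : hcone x -> tangent_cone hcone x =
  [set y | forall j, (x *m A) 0 j = 0 -> 0 <= (y *m A) 0 j].
Proof.
move=> Kx; apply/seteqP; split => [|y xy].
  rewrite [X in _ `<=` X](closure_id _).1; last first.
    exact: (@closed_dual_cone [set j | (x *m A) 0 j = 0]).
  apply: closureS => _ [n [a [s [a0 Ks ->]]]] j xj.
  rewrite coord_sum sumr_ge0// => i _; have [z Kz <-] := Ks i.
  by rewrite coordZ coordD coordN xj subr0 mulr_ge0.
apply: subset_closure; have [e e0 Kxey] := hcone_feasible Kx xy.
(* A single generator suffices: [y] is [e^-1] times the difference of [x + e *: y] and [x]. *)
exists 1%N, (fun=> e^-1), (fun=> e *: y); split => [i|i|].
- by rewrite invr_ge0 ltW.
- by exists (x + e *: y) => //; rewrite addrAC subrr add0r.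
- by rewrite big_ord1 scalerA mulVf ?gt_eqF// scale1r.
Qed.

Lemma convex_tangent_spaceE x : hcone x -> convex_tangent_space hcone x =
  [set y | forall j, (x *m A) 0 j = 0 -> (y *m A) 0 j = 0].
Proof.
move=> Kx; rewrite /convex_tangent_space tangent_coneE//.
apply/seteqP; split => [y [xy [z xz zy]] j xj|y xy].
  apply/eqP; rewrite eq_le xy// andbT -zy coordN oppr_le0; exact: xz.
split => [j /xy ->//|]; exists (- y); rewrite ?opprK// => j /xy.
by rewrite coordN => ->; rewrite oppr0.
Qed.

(** * Generation by extreme rays *)

Hypothesis K_pointed : pointed_cone hcone.

(** This makes the ratio test applicable along every nonzero element of the cone. *)
Lemma pointed_hconeN x : hcone x -> x != 0 -> ~ hcone (- x).
Proof.
move=> Kx x0 KNx; suff : [set 0] x by move=> /eqP; rewrite (negbTE x0).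
by rewrite -K_pointed; split => //; exists (- x); rewrite ?opprK.
Qed.

(** The inactive constraints; their number is the measure for the induction on the elements of the
    cone. *)
Definition slack x : {set 'I_p} := [set j | (x *m A) 0 j != 0]%SET.

(** A failure of the face condition gives [y] in the cone, off the ray of [z], with every constraint
    active at [z] active at [y]. Two ratio tests turn [y] into a splitting of [z] whose summands
    each gain an active constraint. *)
Lemma hcone_split z : hcone z -> z != 0 -> ~ ext hcone z ->
  exists u v, [/\ z = u + v, hcone u /\ hcone v,
    slack u \proper slack z & slack v \proper slack z].
Proof.
move=> Kz z0 Nz.
have [y [w [Ky Kw [a a0 zyw] Nzy]]] : exists y w, [/\ hcone y, hcone w,
    ray z (y + w) & ~ ray z y].
  apply: contrapT => H; apply: Nz; split => //; split.
    by move=> _ [a a0 <-]; exact: hconeZ.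
  move=> y w Ky Kw zyw; split; apply: contrapT => N; apply: H.
    by exists y, w.
  by exists w, y; rewrite addrC.
have zy j : (z *m A) 0 j = 0 -> (y *m A) 0 j = 0.
  move=> zj; have /eqP : (y *m A) 0 j + (w *m A) 0 j = 0.
    by rewrite -coordD -zyw coordZ zj mulr0.
  by rewrite paddr_eq0 ?Ky ?Kw// => /andP[/eqP].
(* Subtracting [z] from [y] makes tight a constraint [i] inactive at [z]; the result [y'] is nonzero
   because [y] is off the ray. *)
have [s [i [s0 Ky' y'i zi]]] := hcone_exit Ky (pointed_hconeN Kz z0).
set y' := y - s *: z in Ky' y'i.
have y'0 : y' != 0.
  apply/eqP => /eqP; rewrite subr_eq0 => /eqP ysz; apply: Nzy.
  by exists s.
have zy' j : (z *m A) 0 j = 0 -> (y' *m A) 0 j = 0.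
  by move=> zj; rewrite coordD coordN coordZ zj mulr0 subr0 zy.
(* Now [z - t *: y'] gains the constraint [j], while [t *: y'] keeps [i] tight. *)
have [t [j [t0 Ku uj y'j]]] := hcone_exit Kz (pointed_hconeN Ky' y'0).
exists (z - t *: y'), (t *: y'); split.
- by rewrite subrK.
- by split => //; exact: hconeZ.
- apply/properP; split.
    apply/fintype.subsetP => h; rewrite !inE; apply: contra => /eqP zh.
    by rewrite coordD coordN coordZ zy'// zh mulr0 subrr.
  exists j; rewrite inE; last by rewrite uj eqxx.
  by apply/eqP => /zy' y'j0; rewrite y'j0 ltxx in y'j.
- apply/properP; split.
    apply/fintype.subsetP => h; rewrite !inE; apply: contra => /eqP zh.
    by rewrite coordZ zy'// mulr0.
  by exists i; rewrite inE; [rewrite gt_eqF | rewrite coordZ y'i mulr0 eqxx].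
Qed.

(* Minkowski's theorem, as an induction principle: a pointed polyhedral cone is
   generated by its extreme rays. *)
Lemma hcone_ext_ind (P : V -> Prop) : P 0 ->
  (forall u v, P u -> P v -> P (u + v)) -> (forall u, ext hcone u -> P u) ->
  forall z, hcone z -> P z.
Proof.
move=> P0 PD Pext z; have [n] := ubnP #|slack z|.
elim: n z => // n IH z; rewrite ltnS => zn Kz.
have [->//|z0] := eqVneq z 0; have [/Pext//|Nz] := pselect (ext hcone z).
have [u [v [zuv [Ku Kv] uz vz]]] := hcone_split Kz z0 Nz.
rewrite zuv; apply: PD; apply: IH => //.
  exact: leq_trans (proper_card uz) zn.
exact: leq_trans (proper_card vz) zn.
Qed.

End PolyhedralCone.

(** * Neighborliness and the supporting functional *)

Lemma rayZ (R : realType) (m : nat) (a : R) (x : 'rV[R]_m) :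
  0 < a -> ray (a *: x) = ray x.
Proof.
move=> a0; apply/seteqP; split => _ [b b0 <-].
  by exists (b * a); rewrite ?scalerA//= mulr_ge0// ltW.
exists (b / a); first by rewrite /= divr_ge0// ltW.
by rewrite scalerA divfK// gt_eqF.
Qed.

Lemma ext_normalize (R : realType) (m : nat) (ip : {dot 'rV[R]_m for idfun})
    (K : set 'rV[R]_m) (x : 'rV[R]_m) : ext K x ->
  exists2 a : R, 0 < a & normalized_ext ip K (a *: x).
Proof.
move=> [x0 Fx]; have ipx : 0 < ip x x by exact: neq0_dnorm_gt0.
have a0 : 0 < (Num.sqrt (ip x x))^-1 by rewrite invr_gt0 sqrtr_gt0.
exists (Num.sqrt (ip x x))^-1 => //; split.
  by split; [rewrite scaler_eq0 gt_eqF | rewrite rayZ].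
rewrite /unit_sphere /= linearZl_LR linearZr_LR /= mulrA -expr2 exprVn.
by rewrite sqr_sqrtr ?ltW// mulVf// gt_eqF.
Qed.

Lemma neighborly_functional (R : realType) (m k p : nat)
    (ip : {dot 'rV[R]_m for idfun}) (A : 'M[R]_(m, p)) (x : 'I_k -> 'rV[R]_m) :
  neighborly ip k (hcone A) -> (forall i, ext (hcone A) (x i)) ->
  exists l : {scalar 'rV[R]_m}, (forall i, l (x i) = 0) /\
    (forall z, hcone A z -> 0 <= l z /\
      (l z = 0 -> exists c : 'I_k -> R, z = \sum_i c i *: x i)).
Proof.
move=> [_ K_pointed _ nK] extx.
have /choice[a ha] : forall i, exists a : R,
    0 < a /\ normalized_ext ip (hcone A) (a *: x i).
  by move=> i; have [a] := ext_normalize ip (extx i); exists a.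
(* Neighborliness concerns unit vectors only, hence the rescaling by [a i]. *)
have [|l [lx l_gt0]] := nK (fun i => a i *: x i); first by move=> i; case: (ha i).
have {}lx i : l (x i) = 0.
  apply/eqP; have := lx i; rewrite linearZ => /eqP.
  by rewrite mulf_eq0 gt_eqF//; case: (ha i).
exists l; split => //; apply: hcone_ext_ind => //.
- rewrite linear0; split => // _; exists (fun=> 0).
  by rewrite big1// => i _; rewrite scale0r.
- move=> u v [lu zu] [lv zv]; rewrite linearD; split; first exact: addr_ge0.
  move=> /eqP; rewrite paddr_eq0// => /andP[/eqP/zu[c ->] /eqP/zv[d ->]].
  exists (fun i => c i + d i); rewrite -big_split /=.
  by apply: eq_bigr => i _; rewrite scalerDl.
- move=> u extu; have [b b0 nbu] := ext_normalize ip extu.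
  have [[i _ xiu]|Nbu] := pselect (range (fun i => a i *: x i) (b *: u)).
    have -> : u = (b^-1 * a i) *: x i.
      by rewrite -scalerA xiu scalerA mulVf ?gt_eqF// scale1r.
    rewrite linearZ lx /= mulr0; split => // _.
    (* The [x i] may repeat, so all the weight goes to the one chosen index. *)
    exists (fun h => if h == i then b^-1 * a i else 0).
    rewrite (bigD1 i)//= eqxx big1 ?addr0// => h /negbTE ->.
    by rewrite scale0r.
  have : 0 < l (b *: u) by apply: l_gt0.
  rewrite linearZ /= pmulr_rgt0// => lu; split; first exact: ltW.
  by move=> lu0; rewrite lu0 ltxx in lu.
Qed.

Theorem corollary3p14 (R : realType) (m k : nat)
    (ip : {dot 'rV[R]_m for idfun}) (K : set 'rV[R]_m) :
  (1 <= k)%N ->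
  polyhedral_cone K -> pointed_cone K -> neighborly ip k K ->
  terracini_convex k K.
Proof.
move=> _ [p [A ->]]; rewrite -/(hcone A) => _ nK x extx.
have Kx i : hcone A (x i).
  by case: (extx i) => _ [+ _]; apply; exists 1; rewrite ?scale1r/=.
have Ksum : hcone A (\sum_i x i) by exact: hcone_sum.
rewrite convex_tangent_spaceE//; apply/seteqP; split => [y xy|].
  have [l [lx lK]] := neighborly_functional nK extx.
  have lsum : l (\sum_i x i) = 0 by rewrite linear_sum big1.
  have [|e e0 Ke] := @hcone_feasible _ _ _ A _ y Ksum.
    by move=> j /xy ->.
  have [|e' e'0 Ke'] := @hcone_feasible _ _ _ A _ (- y) Ksum.
    by move=> j /xy yj; rewrite coordN yj oppr0.
  have [le le0] := lK _ Ke; have [le' _] := lK _ Ke'.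
  have ly : l y = 0.
    apply/eqP; rewrite eq_le; apply/andP; split.
      move: le'; rewrite linearD lsum add0r linearZ linearN /= mulrN oppr_ge0.
      by rewrite pmulr_rle0.
    by move: le; rewrite linearD lsum add0r linearZ /= pmulr_rge0.
  have [|c xey] := le0; first by rewrite linearD lsum add0r linearZ /= ly mulr0.
  (* Solving [\sum_i x i + e *: y = \sum_i c i *: x i] for [y] gives these summands; each convex
     tangent space contains the line through its own [x i]. *)
  exists (fun i => (e^-1 * (c i - 1)) *: x i); split => [i|].
    by rewrite convex_tangent_spaceE// => j xij; rewrite coordZ xij mulr0.
  transitivity (e^-1 *: (\sum_i x i + e *: y - \sum_i x i)).
    by rewrite addrAC subrr add0r scalerA mulVf ?gt_eqF// scale1r.
  rewrite xey -sumrB scaler_sumr; apply: eq_bigr => i _.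
  by rewrite -scalerA scalerBl scale1r.
move=> _ [u [ux ->]] j /eqP; rewrite coord_sum psumr_eq0 => [/allP xj|i _]; last first.
  exact: Kx.
rewrite coord_sum big1// => i _.
have := ux i; rewrite convex_tangent_spaceE//; apply; apply/eqP.
by apply: xj; rewrite mem_index_enum.
Qed.
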